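(* Let $G$ be a strongly regular graph with parameters $(n,t,\lambda,\mu)$ and let $k$ be an integer with $1\le k\le n$. Then $G\in\mathfrak{Gr}(n,k)$ if and only if $$k\ge\max\{n-t,\ n-2t+2\lambda+3,\ n-2t+2\mu-1\},$$ or, equivalently, $t\ge n-k$ and $2\max\{\lambda+1,\mu-1\}\le k+2t-n-1$.
   Context: All graphs are finite, simple and undirected. A graph is strongly regular with parameters $(n,t,\lambda,\mu)$ if it has $n$ vertices, every vertex has degree $t$, any two adjacent vertices have exactly $\lambda$ common neighbours, and any two distinct nonadjacent vertices have exactly $\mu$ common neighbours. For a graph $G=(V,E)$ and $x\in V$, $N[x]=\{x\}\cup\{y: xy\in E\}$. A set $C\subseteq V$ is identifying if $N[x]\cap C\ne\emptyset$ for every $x\in V$ and $N[x]\cap C\neq N[y]\cap C$ for all distinct $x,y\in V$. For $n\ge k\ge1$, $\mathfrak{Gr}(n,k)$ is the set of graphs on $n$ vertices in which every $k$-element subset of vertices is identifying.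
   Formalization: The graph G is additionally assumed to have at least one edge: for an edgeless graph λ is unconstrained, and with k = n the full vertex set is identifying although the bound n-2t+2λ+3 ≤ k fails. *)

(* Defs.v *)
From mathcomp Require Import all_boot all_order all_algebra.

Set Implicit Arguments.
Unset Strict Implicit.
Unset Printing Implicit Defensive.

Record sgraph := SGraph {
  vert :> finType;
  adj : rel vert;
  adj_sym : symmetric adj;
  adj_irrefl : irreflexive adj }.

Definition nbh (G : sgraph) (x : G) : {set G} := [set y | adj x y].

Definition cnbh (G : sgraph) (x : G) : {set G} := x |: nbh x.

(* Edgeless and complete graphs are allowed here; for them lambda, respectively
   mu, is unconstrained. *)
Definition strongly_regular (G : sgraph) (n t lambda mu : nat) : Prop :=
  [/\ #|G| = n,
      forall x : G, #|nbh x| = t,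
      forall x y : G, adj x y -> #|nbh x :&: nbh y| = lambda
    & forall x y : G, x != y -> ~~ adj x y -> #|nbh x :&: nbh y| = mu].

Definition identifying (G : sgraph) (C : {set G}) : Prop :=
  (forall x : G, cnbh x :&: C != set0) /\
  (forall x y : G, x != y -> cnbh x :&: C != cnbh y :&: C).

Definition in_Gr (n k : nat) (G : sgraph) : Prop :=
  #|G| = n /\ forall C : {set G}, #|C| = k -> identifying C.

(* Main.v *)
(* A k-subset C misses a set A exactly when C lies in the complement of A, so
   every k-subset meets A iff n < k + |A|.  The set C is identifying iff it meets
   every closed neighbourhood, of size t + 1, and every symmetric difference of
   two closed neighbourhoods, of size 2t - 2 lambda - 2 for adjacent vertices and
   2t + 2 - 2 mu for nonadjacent ones.  If G is complete then mu is arbitrary, but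
   then G has twins and the lambda-condition already fails. *)
Require Import Defs.
From mathcomp Require Import all_boot all_order all_algebra.
From mathcomp Require Import zify.
Import Order.TTheory GRing.Theory Num.Theory.
Local Open Scope ring_scope.

Section SymmetricDifference.
Local Open Scope nat_scope.
Variable T : finType.
Implicit Types A B C : {set T}.

Definition symdiff A B := (A :\: B) :|: (B :\: A).

(** Splitting [A] and [B] along their intersection counts it twice. The additive form avoids
    truncated subtraction in [nat]. *)
Lemma card_symdiff A B :
  #|symdiff A B| + 2 * #|A :&: B| = #|A| + #|B|.
Proof.
have dAB : [disjoint A :\: B & B :\: A].
  by rewrite -setI_eq0; apply/eqP/setP=> x; rewrite !inE; do 2 case: (x \in _).
rewrite cardsU (disjoint_setI0 dAB) cards0 -(cardsID B A) -(cardsID A B).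
by rewrite [B :&: A]setIC; lia.
Qed.

(** Separating two vertices thus amounts to meeting a symmetric difference, so [meets_k_subsetsP]
    handles both requirements on an identifying set. *)
Lemma symdiff_setI_eq0 A B C :
  (symdiff A B :&: C == set0) = (A :&: C == B :&: C).
Proof.
apply/eqP/eqP => /setP AB; apply/setP=> x; have := AB x;
  by rewrite !inE; do 3 case: (x \in _).
Qed.

Lemma meets_k_subsetsP k A : k <= #|T| ->
  (forall C, #|C| = k -> A :&: C != set0) <-> #|T| < k + #|A|.
Proof.
move=> kT; have cA := cardsC A; split=> [meets | lt_T C cC].
- rewrite ltnNge; apply/negP=> le_T.
  have /card_geqP[s [us ss sA]] : k <= #|~: A| by lia.
  have /negP[] : A :&: [set x in s] != set0.
    by apply: meets; rewrite cardsE (card_uniqP us).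
  rewrite setI_eq0 disjoint_sym disjoints_subset.
  by apply/subsetP=> x; rewrite inE => /sA.
- apply: contraTneq lt_T => /eqP; rewrite setI_eq0 disjoint_sym disjoints_subset.
  by move/subset_leq_card; rewrite cC; lia.
Qed.

End SymmetricDifference.

Arguments symdiff {T} A B.

Section ClosedNeighbourhoods.
Local Open Scope nat_scope.
Variable G : sgraph.
Implicit Types x y : G.

Lemma card_cnbh x : #|cnbh x| = #|nbh x|.+1.
Proof. by rewrite cardsU1 inE adj_irrefl. Qed.

(** The extra 2 counts [x] and [y]: adjacency puts both in each closed neighbourhood, and
    irreflexivity keeps them out of the common open one. *)
Lemma card_cnbhI_adj x y : adj x y ->
  #|cnbh x :&: cnbh y| = #|nbh x :&: nbh y| + 2.
Proof.
move=> xy; have neq_xy : x != y by apply: contraTneq xy => ->; rewrite adj_irrefl.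
have -> : cnbh x :&: cnbh y = x |: (y |: (nbh x :&: nbh y)).
  apply/setP=> z; rewrite !inE.
  case: (eqVneq z x) => [->|_] /=; first by rewrite adj_sym xy orbT.
  by case: (eqVneq z y) => [->|_] /=; rewrite ?xy ?orbT ?andbT.
by rewrite !cardsU1 !inE !adj_irrefl andbF (negbTE neq_xy) /=; lia.
Qed.

Lemma cnbhI_nonadj x y : x != y -> ~~ adj x y ->
  cnbh x :&: cnbh y = nbh x :&: nbh y.
Proof.
move=> neq_xy nxy; apply/setP=> z; rewrite !inE.
case: (eqVneq z x) => [->|_] /=.
  by rewrite adj_irrefl (negbTE neq_xy) adj_sym (negbTE nxy).
by case: (eqVneq z y) => [->|_] //=; rewrite (negbTE nxy).
Qed.

(** A vertex in exactly one of the two closed neighbourhoods is distinct from and nonadjacent to the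
    centre of the other. This supplies a pair to which the [mu] condition applies. *)
Lemma nonadj_of_cnbh_neq x y : cnbh x != cnbh y ->
  exists u v : G, u != v /\ ~~ adj u v.
Proof.
move=> neq; have [z] : exists z, (z \in cnbh x) != (z \in cnbh y).
  apply/existsP; apply: contraR neq => /existsPn eq.
  by apply/eqP/setP=> z; apply/eqP; have := eq z; rewrite negbK.
rewrite !inE; case: (boolP ((z == y) || adj y z)) => [_ | /norP[zy yz] _].
- by rewrite eqb_id => /norP[zx xz]; exists x, z; rewrite eq_sym.
- by exists y, z; rewrite eq_sym.
Qed.

Lemma in_GrP k : k <= #|G| ->
  in_Gr #|G| k G <->
    (forall x, #|G| < k + #|cnbh x|) /\
    (forall x y, x != y -> #|G| < k + #|symdiff (cnbh x) (cnbh y)|).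
Proof.
move=> kG; split=> [[_ idG] | [dom sep]].
- split=> [x | x y xy]; apply/meets_k_subsetsP => // C /idG [dom sep].
  + exact: dom.
  + by rewrite symdiff_setI_eq0; apply: sep.
- split=> // C cC; split=> [x | x y xy].
  + by move/meets_k_subsetsP: (dom x); apply.
  + rewrite -symdiff_setI_eq0.
    by move/meets_k_subsetsP: (sep _ _ xy); apply.
Qed.

End ClosedNeighbourhoods.

Theorem theorem25 (G : sgraph) (n t lambda mu k : nat)
    (G_srg : strongly_regular G n t lambda mu)
    (G_edge : exists x y : G, adj x y)
    (k_bounds : (1 <= k <= n)%N) :
  (in_Gr n k G <->
     Num.max (n%:Z - t%:Z)
       (Num.max (n%:Z - 2 * t%:Z + 2 * lambda%:Z + 3)
                (n%:Z - 2 * t%:Z + 2 * mu%:Z - 1)) <= k%:Z)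
  /\
  (Num.max (n%:Z - t%:Z)
     (Num.max (n%:Z - 2 * t%:Z + 2 * lambda%:Z + 3)
              (n%:Z - 2 * t%:Z + 2 * mu%:Z - 1)) <= k%:Z
   <->
   n%:Z - k%:Z <= t%:Z /\
   2 * Num.max (lambda%:Z + 1) (mu%:Z - 1) <= k%:Z + 2 * t%:Z - n%:Z - 1).
Proof.
split; last by lia.
case: G_srg => cG reg lamG muG; case: G_edge => a [b ab].
have card_c (x : G) : #|cnbh x| = t.+1 by rewrite card_cnbh reg.
have cardD (x y : G) : (#|symdiff (cnbh x) (cnbh y)| + 2 * #|cnbh x :&: cnbh y|
                  = 2 * t.+1)%N by rewrite card_symdiff !card_c; lia.
have cardD_adj (x y : G) : adj x y ->
    (#|symdiff (cnbh x) (cnbh y)| + 2 * (lambda + 2) = 2 * t.+1)%N.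
  by move=> xy; rewrite -(cardD x y) card_cnbhI_adj // lamG.
have cardD_nonadj (x y : G) : x != y -> ~~ adj x y ->
    (#|symdiff (cnbh x) (cnbh y)| + 2 * mu = 2 * t.+1)%N.
  by move=> xy nxy; rewrite -(cardD x y) cnbhI_nonadj // muG.
rewrite -cG in k_bounds *; have [_ kG] := andP k_bounds.
split=> [/(in_GrP _ _ kG) [dom sep] | le_k].
- have neq_ab : a != b by apply: contraTneq ab => ->; rewrite adj_irrefl.
  have sep_ab := sep _ _ neq_ab; have D_ab := cardD_adj _ _ ab.
  (* Twins [a] and [b] would have an empty symmetric difference, and [sep_ab] would read [#|G| < k],
     against [kG]. *)
  have neq_c : cnbh a != cnbh b.
    apply: contraTneq sep_ab => ->.
    by rewrite /symdiff setDv setU0 cards0 addn0 -leqNgt.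
  have [u [v [uv nuv]]] := nonadj_of_cnbh_neq _ _ _ neq_c.
  (* The bound [n - t] comes from [dom a], where the strict inequality absorbs the centre counted in
     [t.+1]; the [lambda] bound comes from the edge [a b], the [mu] bound from the pair [u], [v]. *)
  have := dom a; have := sep _ _ uv; have := cardD_nonadj _ _ uv nuv.
  by rewrite card_c; lia.
- apply/in_GrP => //; split=> [x | x y xy]; first by rewrite card_c; lia.
  by case: (boolP (adj x y)) => [/cardD_adj | /(cardD_nonadj _ _ xy)]; lia.
Qed.
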